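(* For every $n\geq1$, the sum of the coefficients of the non-commutative polynomial $\hat\Phi_n(\mathbf c,-\mathbf d)=\Phi_n(\mathbf c,\mathbf c^2+\mathbf d)$ equals $|\mathcal R_n|$.
   Context: For $S\subseteq[n-1]$ let $u_S=u_1\cdots u_{n-1}$ with $u_i=\mathbf a$ if $i\notin S$, $u_i=\mathbf b$ if $i\in S$ (non-commuting variables). Let $\beta_n(S)$ be the number of $\sigma\in\mathfrak S_n$ with descent set $\{i:\sigma_i>\sigma_{i+1}\}=S$ and $\Psi_n(\mathbf a,\mathbf b)=\sum_S\beta_n(S)u_S$. The $cd$-index $\Phi_n(\mathbf c,\mathbf d)$ of the Boolean algebra $B_n$ is the (known to exist, unique) polynomial in non-commuting $\mathbf c,\mathbf d$ with $\Psi_n(\mathbf a,\mathbf b)=\Phi_n(\mathbf a+\mathbf b,\mathbf a\mathbf b+\mathbf b\mathbf a)$. Define $\hat\Phi_n(\mathbf c,\mathbf d)=\Phi_n(\mathbf c,\mathbf c^2-\mathbf d)$. $\mathcal R_n$ is the set of permutations $\sigma\in\mathfrak S_n$ with no consecutive descents (no $i$ with $\sigma_i>\sigma_{i+1}>\sigma_{i+2}$) and not ending with a descent (not $\sigma_{n-1}>\sigma_n$). *)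

(* Defs.v *)
From HB Require Import structures.
From mathcomp Require Import all_boot all_order all_algebra all_fingroup.
From mathcomp Require Import finmap.
From mathcomp Require Import zify.
From mathcomp.multinomials Require Import monalg.

Set Implicit Arguments.
Unset Strict Implicit.
Unset Printing Implicit Defensive.

Import GRing.Theory.
Local Open Scope ring_scope.

(* Integer polynomials in two non-commuting variables [ncX false] and
   [ncX true], which play the role of (a, b) as well as of (c, d). *)
Notation ncpoly := {malg int[{fmonom bool}]}.

Definition ncX (i : bool) : ncpoly := << fmu i >>.

(* P(x, y) for elements x and y of an arbitrary, possibly non-commutative,
   ring; the product runs along the letters of the word m from left to
   right. *)
Definition nceval (S : nzRingType) (x y : S) (P : ncpoly) : S :=
  mmap intr (fun m : {fmonom bool} => \prod_(i <- m) (if i then y else x)) P.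

Definition sum_coef (P : ncpoly) : int := \sum_(m <- msupp P) P@_m.

Section Permutations.
Variable n : nat.
Implicit Types (s : 'S_n) (S : {set 'I_n.-1}).

(* Positions are counted from 0: the position k here is the position k + 1 of
   the one-line notation, and k : 'I_n.-1 stands for the element k + 1 of
   [n-1].  There is no descent at k unless k.+1 < n. *)
Definition descent s (k : nat) : bool :=
  [exists i : 'I_n, exists j : 'I_n,
    [&& i == k :> nat, j == k.+1 :> nat & (s j < s i)%N]].

Definition descent_set s : {set 'I_n.-1} := [set k : 'I_n.-1 | descent s k].

Definition beta S : nat := #|[set s : 'S_n | descent_set s == S]|.

Definition u_word S : ncpoly := \prod_(k < n.-1) ncX (k \in S).

Definition Psi : ncpoly := \sum_(S : {set 'I_n.-1}) u_word S *+ beta S.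

(* For n = 1 the last condition is vacuous: [descent s 0] is then false. *)
Definition Rset : {set 'S_n} :=
  [set s : 'S_n | [forall k : 'I_n, ~~ (descent s k && descent s k.+1)]
                  && ~~ descent s (n - 2)].

End Permutations.

Definition is_cd_index (n : nat) (Phi : ncpoly) : Prop :=
  let a := ncX false in
  let b := ncX true in
  Psi n = nceval (a + b) (a * b + b * a) Phi.

Definition hat (Phi : ncpoly) : ncpoly :=
  let c := ncX false in
  let d := ncX true in
  nceval c (c ^+ 2 - d) Phi.

Section Evaluation.
Variables (S : nzRingType) (x y : S).

Lemma nceval_is_zmod_morphism : zmod_morphism (nceval x y).
Proof. by move=> P Q; rewrite /nceval raddfB. Qed.

HB.instance Definition _ :=
  GRing.isZmodMorphism.Build ncpoly S (nceval x y) nceval_is_zmod_morphism.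

Lemma ncevalU c (m : {fmonom bool}) :
  nceval x y << c *g m >> = c%:~R * \prod_(i <- m) (if i then y else x).
Proof. by rewrite /nceval mmapU. Qed.

Lemma nceval_is_monoid_morphism : monoid_morphism (nceval x y).
Proof.
split=> [|P Q]; first by rewrite ncevalU fm1 big_nil mulr1.
rewrite malgME raddf_sum [in RHS](monalgE P) raddf_sum mulr_suml /=.
apply: eq_bigr=> i _.
rewrite raddf_sum [in RHS](monalgE Q) raddf_sum mulr_sumr /=; apply: eq_bigr=> j _.
rewrite !ncevalU fmM big_cat /= intrM -!mulrA; congr (_ * _).
by rewrite !mulrA commr_int.
Qed.

HB.instance Definition _ :=
  GRing.isMonoidMorphism.Build ncpoly S (nceval x y) nceval_is_monoid_morphism.

Lemma ncevalX i : nceval x y (ncX i) = if i then y else x.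
Proof. by rewrite ncevalU mul1r fmU big_seq1. Qed.

End Evaluation.

Lemma ncX_word (m : {fmonom bool}) : << m >> = \prod_(i <- m) ncX i :> ncpoly.
Proof.
case: m=> l /=; elim: l=> [|i l IH]; first by rewrite big_nil -fmoneE.
rewrite big_cons -IH /ncX malgM_def fgmulUU mulr1; congr << _ >>.
by apply/eqP; rewrite fmP fmM fmU.
Qed.

Lemma ncpoly_morph_ext (S : nzRingType) (f g : {rmorphism ncpoly -> S}) :
  (forall i, f (ncX i) = g (ncX i)) -> f =1 g.
Proof.
move=> fg P; rewrite (monalgE P) !raddf_sum; apply: eq_bigr=> m _.
have -> : << P@_m *g m >> = << m >> *~ P@_m :> ncpoly.
  by rewrite -(raddfMz (mkmalgU m)) intz.
rewrite !raddfMz /= ncX_word !rmorph_prod; congr (_ *~ _).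
by apply: eq_bigr=> i _; rewrite fg.
Qed.

(* Existence of the cd-index.  Inserting the largest entry at all places of a
   permutation gives Psi_(n+1) = Psi_n (a + b) + G(Psi_n), where G is the
   derivation with G(a) = ba and G(b) = ab.  It maps a + b to ab + ba and
   ab + ba to (a + b)(ab + ba), and so acts on polynomials in a + b and
   ab + ba. *)

(* The matrix (x y; 0 x): a ring morphism P |-> dm P (G P) is the same as a
   derivation G. *)
Definition dm (S : nzRingType) (x y : S) : 'M[S]_2 :=
  \matrix_(i, j) if i == j then x else if i == 0 then y else 0.

Section DerivationMatrix.
Variable S : nzRingType.
Implicit Types x y : S.

Lemma dm01 x y : dm x y 0 1 = y.
Proof. by rewrite mxE. Qed.

Lemma dmM x y x' y' : dm x y * dm x' y' = dm (x * x') (x * y' + y * x').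
Proof.
apply/matrixP=> i j; rewrite !mxE !big_ord_recl big_ord0 !mxE addr0.
move: i j => [[|[|//]] ?] [[|[|//]] ?].
all: by rewrite -!val_eqE /= ?mulr0 ?mul0r ?addr0 ?add0r.
Qed.

Lemma dmD x y x' y' : dm x y + dm x' y' = dm (x + x') (y + y').
Proof.
by apply/matrixP=> i j; rewrite !mxE; do 2!case: ifP=> // _; rewrite addr0.
Qed.

Lemma dm1 : dm 1 0 = 1 :> 'M[S]_2.
Proof.
by apply/matrixP=> i j; rewrite !mxE; case: eqP => // _; case: ifP.
Qed.

End DerivationMatrix.

Section Insertion.
Variables (R : nzRingType) (X : bool -> R).
Variables (sub : {rmorphism R -> R}) (rho rho' : {rmorphism R -> 'M[R]_2}).
Let a := X false.
Let b := X true.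
Hypotheses (suba : sub a = a + b) (subb : sub b = a * b + b * a).
Hypotheses (rhoa : rho a = dm a (b * a)) (rhob : rho b = dm b (a * b)).
Hypotheses (rho'a : rho' a = dm a b) (rho'b : rho' b = dm b (a * b)).

Lemma rho_sub_gen i : rho (sub (X i)) = map_mx sub (rho' (X i)).
Proof.
have map_dm x y : map_mx sub (dm x y) = dm (sub x) (sub y).
  by apply/matrixP=> k l; rewrite !mxE; do 2!case: ifP=> // _; rewrite raddf0.
case: i; rewrite -/a -/b ?rho'a ?rho'b map_dm ?rmorphM ?suba ?subb raddfD /=.
  rewrite !rmorphM /= rhoa rhob !dmM dmD; congr (dm _ _).
  rewrite mulrDl !mulrDr !mulrA -!addrA.
  by congr (_ + _); rewrite addrA addrC.
by rewrite rhoa rhob dmD [b * a + _]addrC.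
Qed.

(* The descents after an insertion of the largest entry at the position i. *)
Definition ins (u : nat -> bool) (i k : nat) : bool :=
  if (k.+1 < i)%N then u k else
  if k.+1 == i then false else
  if k == i then true else u k.-1.

Definition word (u : nat -> bool) (m : nat) : R := \prod_(0 <= k < m) X (u k).

Lemma wordS u m : word u m.+1 = word u m * X (u m).
Proof. by rewrite /word big_nat_recr. Qed.

Lemma insS u m (i : nat) : (i <= m)%N ->
  word (ins u i) m.+2 = word (ins u i) m.+1 * X (u m).
Proof.
move=> im; rewrite wordS; congr (_ * X _).
by rewrite /ins !ifF //; apply/negbTE; lia.
Qed.

Lemma ins_last u m : word (ins u m.+1) m.+1 = word u m * a.
Proof.
rewrite wordS {2}/ins ltnn eqxx; congr (_ * _).
by apply: eq_big_nat=> k km; rewrite /ins ifT.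
Qed.

Lemma ins_prev u m : word (ins u m.+1) m.+2 = word u m * a * b.
Proof.
rewrite wordS ins_last; congr (_ * _).
by rewrite /ins 2?ifF ?eqxx //; apply/negbTE; lia.
Qed.

Lemma rho_word u m :
  rho (word u m) =
  dm (word u m) (\sum_(i < m.+2) word (ins u i) m.+1 - word u m * (a + b)).
Proof.
elim: m=> [|m IH].
  rewrite /word big_nil rmorph1 -dm1; congr (dm _ _).
  by rewrite big_ord_recr big_ord1 /= !big_nat1 /= mul1r addrC subrr.
rewrite wordS rmorphM /= IH.
rewrite big_ord_recr [in RHS]big_ord_recr [in RHS]big_ord_recr /=.
rewrite !ins_last ins_prev wordS.
under [in RHS]eq_bigr=> i _ do rewrite (insS u (leq_ord i)).
rewrite -mulr_suml; set Q := \sum_(i < m.+1) _; set P := word u m.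
case: (u m); rewrite -/a -/b ?rhoa ?rhob dmM; congr (dm _ _).
all: rewrite !mulrDr !mulrDl ?mulNr ?mulrDl ?mulrA ?opprD.
all: by rewrite !addrA !addrK [X in X - _]addrC ?addrK.
Qed.

End Insertion.

Section InsertMax.
Variable m : nat.
Implicit Types (s : 'S_m.+1) (i : 'I_m.+2).

Lemma descentE n (s : 'S_n) (i j : 'I_n) :
  j = i.+1 :> nat -> descent s i = (s j < s i)%N.
Proof.
move=> ji; apply/existsP/idP => [[i' /existsP [j' /and3P [/eqP ii' /eqP jj']]]|].
  by rewrite (val_inj ii') (_ : j' = j) //; apply: val_inj; rewrite /= jj' ji.
by move=> lt; exists i; apply/existsP; exists j; rewrite eqxx ji eqxx.
Qed.

Lemma lift_max_lt s i (x : 'I_m.+2) :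
  (x < i)%N -> lift_perm i ord_max s x = s (inord x) :> nat.
Proof.
move=> xi; have xm : (x < m.+1)%N by have := ltn_ord i; lia.
have {1}-> : x = lift i (inord x).
  by apply: val_inj; rewrite /= inordK // /bump leqNgt xi.
by rewrite lift_perm_lift lift_max.
Qed.

Lemma lift_max_gt s i (x : 'I_m.+2) :
  (i < x)%N -> lift_perm i ord_max s x = s (inord x.-1) :> nat.
Proof.
move=> ix; have xm : (x.-1 < m.+1)%N by have := ltn_ord x; lia.
have {1}-> : x = lift i (inord x.-1).
  by apply: val_inj; rewrite /= inordK // /bump; lia.
by rewrite lift_perm_lift lift_max.
Qed.

Lemma descent_lift s i (k : nat) :
  (k < m.+1)%N -> descent (lift_perm i ord_max s) k = ins (descent s) i k.
Proof.
move=> km; set t := lift_perm _ _ _.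
have ltk : (k < m.+2)%N by lia.
rewrite (@descentE _ t (Ordinal ltk) (Ordinal (km : k.+1 < m.+2)%N)) //.
have t_i : t i = m.+1 :> nat by rewrite lift_perm_id.
have t_le x : (t x <= m.+1)%N by rewrite -ltnS.
rewrite /ins; case: (ltngtP k.+1 i)=> [ki|ik|ki].
- rewrite /t !lift_max_lt /=; [|lia|lia].
  have km' : (k.+1 < m.+1)%N by have := ltn_ord i; lia.
  by rewrite -(@descentE _ s (inord k) (inord k.+1)) ?inordK //; lia.
- case: eqP=> [{}ki|ki].
    rewrite (_ : Ordinal ltk = i) ?t_i; last exact: val_inj.
    by rewrite /t lift_max_gt /= ?ltn_ord // -ki.
  rewrite /t !lift_max_gt /=; [|lia|lia].
  by rewrite -(@descentE _ s (inord k.-1) (inord k)) ?inordK //; lia.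
- rewrite (_ : Ordinal (km : k.+1 < m.+2)%N = i) ?t_i; last exact: val_inj.
  by apply/negbTE; rewrite -leqNgt.
Qed.

Lemma lift_max_bij :
  bijective (fun p : 'I_m.+2 * 'S_m.+1 => lift_perm p.1 ord_max p.2).
Proof.
apply: inj_card_bij; last first.
  by rewrite card_prod card_ord !card_Sn factS.
move=> [i s] [i' s'] /= eq_t.
have ii' : i = i'.
  apply: (@perm_inj _ (lift_perm i ord_max s)).
  by rewrite {2}eq_t !lift_perm_id.
subst i'; congr (_, _); apply/permP=> k.
by apply: (@lift_inj _ ord_max); rewrite -!(lift_perm_lift i) eq_t.
Qed.

End InsertMax.

Lemma Psi_word n : Psi n = \sum_(s : 'S_n) word ncX (descent s) n.-1.
Proof.
rewrite (partition_big (@descent_set n) predT) //=; apply: eq_bigr=> S _.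
rewrite /beta -sumr_const; apply: eq_big=> [s|s]; rewrite inE // => /eqP <-.
by rewrite /word big_mkord; apply: eq_bigr=> k _; rewrite inE.
Qed.

Lemma Psi_insert m :
  Psi m.+2 =
  \sum_(s : 'S_m.+1) \sum_(i < m.+2) word ncX (ins (descent s) i) m.+1.
Proof.
rewrite Psi_word (reindex _ (onW_bij _ (lift_max_bij m))) /=.
rewrite exchange_big pair_big /=; apply: eq_bigr=> -[i s] _ /=.
by apply: eq_big_nat => k /andP [_ km]; rewrite descent_lift.
Qed.

Lemma cd_index_exists n : exists Phi, is_cd_index n Phi.
Proof.
have base k : (k.-1 = 0)%N -> exists Phi, is_cd_index k Phi.
  move=> k0; exists (#|{: 'S_k}|%:R).
  rewrite /is_cd_index rmorph_nat Psi_word k0.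
  by under eq_bigr do rewrite /word big_nil; rewrite sumr_const.
case: n=> [|n]; first exact: base.
elim: n=> [|m [Phi]]; first exact: base.
pose a := ncX false; pose b := ncX true.
rewrite /is_cd_index.
pose sub : {rmorphism ncpoly -> ncpoly} := nceval (a + b) (a * b + b * a).
pose rho : {rmorphism ncpoly -> 'M[ncpoly]_2} :=
  nceval (dm a (b * a)) (dm b (a * b)).
pose rho' : {rmorphism ncpoly -> 'M[ncpoly]_2} :=
  nceval (dm a b) (dm b (a * b)).
rewrite -/a -/b -[nceval _ _]/(sub : _ -> _) => IH.
have suba : sub a = a + b by exact: ncevalX.
have subb : sub b = a * b + b * a by exact: ncevalX.
have rhoa : rho a = dm a (b * a) by exact: ncevalX.
have rhob : rho b = dm b (a * b) by exact: ncevalX.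
have rho'a : rho' a = dm a b by exact: ncevalX.
have rho'b : rho' b = dm b (a * b) by exact: ncevalX.
have := @ncpoly_morph_ext _ (rho \o sub) (map_mx sub \o rho')
  (@rho_sub_gen _ ncX sub rho rho' suba subb rhoa rhob rho'a rho'b).
have := @rho_word _ ncX rho rhoa rhob.
rewrite -/a -/b.
move: sub rho rho' IH suba {subb rhoa rhob rho'a rho'b}.
move=> sub rho rho' IH suba rhoW rho_sub.
exists (Phi * a + rho' Phi 0 1).
rewrite Psi_insert raddfD /= rmorphM /= suba -IH.
have -> : sub (rho' Phi 0 1) = rho (sub Phi) 0 1.
  by rewrite [rho (sub Phi)]rho_sub mxE.
rewrite -IH Psi_word raddf_sum summxE mulr_suml -big_split /=.
by apply: eq_bigr=> s _; rewrite rhoW dm01 addrC subrK.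
Qed.

(* Main.v *)
Require Import Defs.
From mathcomp Require Import all_boot all_order all_algebra all_fingroup.
From mathcomp.multinomials Require Import monalg.
Import GRing.Theory Num.Theory.
Local Open Scope ring_scope.

Set Implicit Arguments.
Unset Strict Implicit.
Unset Printing Implicit Defensive.

(* Splitting a permutation at its minimum gives
     Psi_(m+1) = sum_k C(m, k) (Psi_k b) (a Psi_(m-k)),
   where Psi_k b is replaced by 1 if k = 0 and a Psi_(m-k) by 1 if m - k = 0.
   Instead of a bijective proof, both sides are shown to satisfy the insertion
   recurrence Psi_(m+1) = Psi_m (a + b) + G(Psi_m), G being the derivation with
   G(a) = ba and G(b) = ab, encoded as in the existence proof of the cd-index.
   The upper left entries of the transfer matrices of the words without bb that
   do not end with b send Psi_n to |R_n|, so that r_n = |R_n| satisfies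
     r_(m+1) = r_m + sum_(0 < k < m) C(m, k) r_k r_(m-k).
   In a ring with a + b = 1 = b a the images of the Psi_n satisfy the same
   recurrence, whence Psi_n(a, b) = r_n there.  Then c = a + b = 1 and
   d = ab + ba = 2, so that Psi_n(a, b) = Phi_n(1, 2), which is the sum of the
   coefficients of Phi_n(c, c^2 + d). *)

Lemma nceval_comp (S T : nzRingType) (f : {rmorphism S -> T}) (x y : S) P :
  f (nceval x y P) = nceval (f x) (f y) P.
Proof.
apply: (@ncpoly_morph_ext _ (f \o nceval x y) (nceval (f x) (f y))) => i /=.
by rewrite !ncevalX; case: i.
Qed.

Lemma sum_coefE P : sum_coef P = nceval 1 1 P.
Proof.
rewrite /sum_coef /nceval /mmap; apply: eq_bigr => m _.
by rewrite intz big1 ?mulr1 // => i _; case: i.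
Qed.

Lemma dm0 (S : nzRingType) : dm 0 0 = 0 :> 'M[S]_2.
Proof.
by apply/matrixP => k l; rewrite !mxE; do 2?case: ifP.
Qed.

Lemma dm_sum (S : nzRingType) (I : Type) (r : seq I) (x y : I -> S) :
  \sum_(i <- r) dm (x i) (y i) = dm (\sum_(i <- r) x i) (\sum_(i <- r) y i).
Proof.
by elim: r => [|i r IH]; rewrite ?big_nil ?dm0 // !big_cons IH dmD.
Qed.

(** * The recurrence from splitting at the minimum *)

Section SplitAtMinimum.
Variables (R : nzRingType) (a b : R) (p : nat -> R).
Variable rho : {rmorphism R -> 'M[R]_2}.
Hypotheses (rhoa : rho a = dm a (b * a)) (rhob : rho b = dm b (a * b)).
Hypothesis p1 : p 1%N = 1.
Hypothesis rho_p :
  forall m, rho (p m.+1) = dm (p m.+1) (p m.+2 - p m.+1 * (a + b)).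

Definition before_min k : R := if k is 0%N then 1 else p k * b.
Definition after_min l : R := if l is 0%N then 1 else a * p l.

(** In the Leibniz rule for [p k * b] the terms [p k * a * b] cancel: one comes from the derivative
    of [p k], the other from that of [b]. The formula extends to [k = 0] because [p 1 = 1]. *)
Lemma rho_before_min k : rho (before_min k) =
  dm (before_min k) (before_min k.+1 - before_min k * b).
Proof.
case: k => [|k] /=; first by rewrite p1 !mul1r subrr rmorph1 dm1.
rewrite rmorphM /= rho_p rhob dmM; congr (dm _ _).
by rewrite mulrBl mulrDr mulrDl !mulrA opprD addrCA addNKr.
Qed.

Lemma rho_after_min l : rho (after_min l) =
  dm (after_min l) (after_min l.+1 + b * after_min l - after_min l * (a + b)).
Proof.
case: l => [|l] /=; first by rewrite p1 mul1r !mulr1 subrr rmorph1 dm1.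
rewrite rmorphM /= rho_p rhoa dmM; congr (dm _ _).
by rewrite mulrBr !mulrA addrAC.
Qed.

Lemma split_at_min m : p m.+1 =
  \sum_(k < m.+1) (before_min k * after_min (m - k)) *+ 'C(m, k).
Proof.
elim: m => [|m IH]; first by rewrite p1 big_ord1 mulr1.
have := congr1 rho IH; rewrite rho_p raddf_sum /=.
(* Leibniz rule: the two factors contribute [before_min k * b * after_min l] with opposite signs. *)
have E k l : rho (before_min k * after_min l) =
    dm (before_min k * after_min l)
       (before_min k * after_min l.+1 + before_min k.+1 * after_min l
        - before_min k * after_min l * (a + b)).
  rewrite rmorphM /= rho_before_min rho_after_min dmM.
  congr (dm _ _); rewrite mulrBr mulrDr mulrBl !mulrA.
  by rewrite addrAC -!addrA; congr (_ + _); rewrite addrCA addrA addrA addrK.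
pose P k := before_min k * after_min (m - k).
pose Q k := before_min k * after_min (m - k).+1 +
            before_min k.+1 * after_min (m - k).
rewrite (eq_bigr (fun k : 'I_m.+1 =>
  dm (P k *+ 'C(m, k)) (Q k *+ 'C(m, k) - (P k *+ 'C(m, k)) * (a + b)))).
  (* The upper right entry holds the derivative; by induction the multiples of [a + b] agree on both
     sides and drop out. *)
  rewrite dm_sum => /(congr1 (fun M : 'M_2 => M 0 1)); rewrite !dm01.
  rewrite sumrB -mulr_suml -IH => /addIr ->.
  under [LHS]eq_bigr do rewrite /Q mulrnDl.
  rewrite big_split /= [RHS]big_ord_recl /= bin0.
  (* Pascal's rule matches the remaining terms with the two sums on the left. *)
  under [in RHS]eq_bigr do rewrite /bump /= add1n binS mulrnDr subSS.
  rewrite [in RHS]big_split /= [in RHS]addrA; congr (_ + _).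
  rewrite [in RHS]big_ord_recr /= bin_small // mulr0n addr0.
  rewrite big_ord_recl bin0; congr (_ + _); first by rewrite /= subn0.
  apply: eq_bigr => k _.
  by rewrite /= -(subnSK (ltn_ord k)).
move=> k _; rewrite raddfMn /= E -/(P k) -/(Q k).
elim: 'C(m, k) => [|c IHc].
  by rewrite !mulr0n mul0r subrr dm0.
by rewrite !mulrSr IHc dmD mulrDl opprD addrACA.
Qed.

(** The terms with the minimum in first or last place are split off; in the others both blocks are
    nonempty, so the convention for empty blocks disappears. *)
Lemma split_at_min_rec m : p m.+2 = a * p m.+1 + p m.+1 * b +
  \sum_(k < m) (p k.+1 * b * a * p (m - k)) *+ 'C(m.+1, k.+1).
Proof.
rewrite split_at_min big_ord_recl big_ord_recr /= bin0 binn mul1r !mulr1n.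
rewrite /bump !add1n subnn /= mulr1 addrA addrAC; congr (_ + _).
apply: eq_bigr => k _; rewrite add1n subSS.
by case: (m - k)%N (ltn_ord k) (subn_gt0 k m) => [-> //|l] _ _; rewrite !mulrA.
Qed.

Lemma rmorph_split_rec (S : nzRingType) (f : {rmorphism R -> S}) m :
  f (p m.+2) = f a * f (p m.+1) + f (p m.+1) * f b +
  \sum_(k < m) (f (p k.+1) * f b * f a * f (p (m - k))) *+ 'C(m.+1, k.+1).
Proof.
rewrite split_at_min_rec !rmorphD rmorph_sum /= !rmorphM; congr (_ + _).
by apply: eq_bigr => k _; rewrite rmorphMn /= !rmorphM.
Qed.

End SplitAtMinimum.

Lemma Psi1 : Psi 1 = 1.
Proof.
rewrite Psi_word (eq_bigr (fun=> 1)); last by move=> s _; rewrite /word big_nil.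
by rewrite sumr_const card_Sn.
Qed.

(** The target ring is arbitrary since two kinds of images are needed: under the transfer matrices,
    and in rings with [a + b = b * a = 1]. *)
Lemma rmorph_Psi_rec (S : nzRingType) (f : {rmorphism ncpoly -> S}) m :
  f (Psi m.+2) = f (ncX false) * f (Psi m.+1) + f (Psi m.+1) * f (ncX true) +
  \sum_(k < m) (f (Psi k.+1) * f (ncX true) * f (ncX false) * f (Psi (m - k)))
    *+ 'C(m.+1, k.+1).
Proof.
pose a := ncX false; pose b := ncX true.
pose rho : {rmorphism ncpoly -> 'M[ncpoly]_2} :=
  nceval (dm a (b * a)) (dm b (a * b)).
have rhoa : rho a = dm a (b * a) by exact: ncevalX.
have rhob : rho b = dm b (a * b) by exact: ncevalX.
move: rho rhoa rhob => rho rhoa rhob.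
apply: (rmorph_split_rec rhoa rhob Psi1) => {}m.
rewrite Psi_insert Psi_word raddf_sum /= mulr_suml -sumrB -dm_sum.
by apply: eq_bigr => s _; rewrite (rho_word rhoa rhob).
Qed.

(** * Counting [Rset] by transfer matrices *)

Lemma mul_mx2E (S : nzRingType) (M N : 'M[S]_2) i j :
  (M * N) i j = M i 0 * N 0 j + M i 1 * N 1 j.
Proof.
rewrite mxE !big_ord_recl big_ord0 addr0.
by have -> : lift ord0 (ord0 : 'I_1) = 1 :> 'I_2 by apply: val_inj.
Qed.

(* Row 0 is the state after a (or at the start), row 1 the state after b. *)
Definition step_a : 'M[int]_2 := \matrix_(i, j) (j == 0)%:R.
Definition step_b : 'M[int]_2 := delta_mx 0 1.

(** Row 1 of [step_b] is zero, so a [b] after a [b] kills the product; otherwise the column of the 1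
    in row 0 records the last letter. *)
Lemma step_word (u : nat -> bool) m :
  let M := word (fun i => if i then step_b else step_a) u m in
  let run := all (fun k => ~~ (u k && u k.+1)) (iota 0 m.-1) in
  let last := (0 < m)%N && u m.-1 in
  (M 0 0 = (run && ~~ last)%:R) /\ (M 0 1 = (run && last)%:R).
Proof.
elim: m => [|m [IH0 IH1]] /=; first by rewrite /word big_nil !mxE.
rewrite wordS !mul_mx2E IH0 IH1.
have -> : all (fun k => ~~ (u k && u k.+1)) (iota 0 m) =
    all (fun k => ~~ (u k && u k.+1)) (iota 0 m.-1) &&
    ~~ [&& (0 < m)%N, u m.-1 & u m].
  case: m {IH0 IH1} => [//|m].
  by rewrite -[X in iota 0 X]addn1 iotaD all_cat /= andbT.
case: (all _ _) => /=; last by rewrite !mul0r.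
rewrite andbA; case: ((0 < m)%N && u m.-1); case: (u m);
  by rewrite !mxE /= ?(mul0r, mul1r, mulr1, addr0, add0r).
Qed.

Lemma descent_oversize n (s : 'S_n) k : (n <= k.+1)%N -> descent s k = false.
Proof.
move=> nk; apply/negbTE/existsP => -[i /existsP[j /and3P[_ /eqP jk _]]].
by have := ltn_ord j; rewrite jk ltnNge nk.
Qed.

Lemma Rset_word n (s : 'S_n.+1) :
  (s \in Rset n.+1)%:R =
  word (fun i => if i then step_b else step_a) (descent s) n 0 0.
Proof.
have [-> _] := step_word (descent s) n; congr ((nat_of_bool _)%:R).
rewrite inE subSS subn1; congr (_ && ~~ _).
  apply/forallP/allP => [H k|H k].
    rewrite mem_iota /= => kn; have lt : (k < n.+1)%N.
      by apply: leq_trans kn _; rewrite add0n (leq_trans (leq_pred _)).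
    exact: (H (Ordinal lt)).
  (* [Rset] quantifies over more positions than the word has adjacent pairs; for [k >= n.-1] the
     position [k.+1] is too far right for a descent. *)
  have [lt|ge] := ltnP k n.-1; first by apply: H; rewrite mem_iota.
  rewrite [X in _ && X]descent_oversize ?andbF //.
  by rewrite ltnS (leq_trans (leqSpred n)).
by case: n s => [|n] s //=; rewrite descent_oversize.
Qed.

Lemma card_Rset n :
  #|Rset n.+1|%:R = nceval step_a step_b (Psi n.+1) 0 0.
Proof.
rewrite Psi_word raddf_sum summxE /= -sum1_card natr_sum big_mkcond /=.
apply: eq_bigr => s _; rewrite rmorph_prod /=.
rewrite (eq_bigr _ (fun i _ => ncevalX _ _ _)) -[RHS]Rset_word.
by case: (s \in _).
Qed.

Lemma card_Rset1 : #|Rset 1| = 1%N.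
Proof.
by apply/eqP; rewrite -(eqr_nat int) card_Rset Psi1 rmorph1 mxE.
Qed.

(** This is the entry (0, 0) of the recurrence for [Psi]. The term with the minimum last vanishes
    because column 0 of [step_b] is zero, and the inner terms factor because [step_b * step_a] is
    the matrix unit at (0, 0). *)
Lemma card_Rset_rec m : #|Rset m.+2| = (#|Rset m.+1| +
  \sum_(k < m) 'C(m.+1, k.+1) * (#|Rset k.+1| * #|Rset (m - k)|))%N.
Proof.
apply/eqP; rewrite -(eqr_nat int); apply/eqP.
pose f : {rmorphism ncpoly -> 'M[int]_2} := nceval step_a step_b.
have fa : f (ncX false) = step_a by exact: ncevalX.
have fb : f (ncX true) = step_b by exact: ncevalX.
have card_R k : #|Rset k.+1|%:R = f (Psi k.+1) 0 0 by exact: card_Rset.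
move: f fa fb card_R => f fa fb card_R.
rewrite natrD natr_sum !card_R rmorph_Psi_rec fa fb.
have A_00 M : (step_a * M) 0 0 = M 0 0.
  by rewrite mul_mx2E !mxE mul1r mul0r addr0.
have B_00 M : (M * step_b) 0 0 = 0 by rewrite mul_mx2E !mxE !mulr0 addr0.
have BA_00 M N : (M * step_b * step_a * N) 0 0 = M 0 0 * N 0 0.
  rewrite -[_ * _ * step_a]mulrA !(mul_mx2E _ _ 0) !mul_mx2E !mxE /=.
  by rewrite ?(mul0r, mulr0, mul1r, mulr1, addr0, add0r).
rewrite mxE [X in X + _]mxE summxE A_00 B_00 addr0.
congr (_ + _); apply: eq_bigr => k _.
rewrite mulmxnE BA_00 natrM natrM mulr_natl card_R.
have := subn_gt0 k m; rewrite ltn_ord; case: (m - k)%N => [//|l] _.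
by rewrite card_R.
Qed.

(** By induction the earlier values are integers, hence central: the two outer terms of the
    recurrence combine through [a + b = 1], and [b * a = 1] turns each inner term into a product of
    cardinalities. *)
Lemma rmorph_Psi (S : nzRingType) (f : {rmorphism ncpoly -> S}) n :
  f (ncX false) + f (ncX true) = 1 -> f (ncX true) * f (ncX false) = 1 ->
  f (Psi n.+1) = #|Rset n.+1|%:R.
Proof.
move=> fab1 fba1; elim/ltn_ind: n => -[|n] IH.
  by rewrite Psi1 rmorph1 card_Rset1.
rewrite rmorph_Psi_rec card_Rset_rec natrD natr_sum IH //.
rewrite mulr_natr mulr_natl -mulrnDl fab1; congr (_ + _).
apply: eq_bigr => k _; rewrite -[f _ * _ * _]mulrA fba1 mulr1.
rewrite IH ?ltnS ?(ltnW (ltn_ord k)) //.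
have := subn_gt0 k n; rewrite ltn_ord; case E: (n - k)%N => [//|l] _.
rewrite IH; first by rewrite !natrM -[LHS]mulr_natl.
by rewrite ltnS ltnW // -E leq_subr.
Qed.

(** * Passage to the cd-index *)

Lemma nceval_hat (S : nzRingType) (x y : S) P :
  nceval x (- y) (hat P) = nceval x (x ^+ 2 + y) P.
Proof.
by rewrite /hat nceval_comp /= rmorphB /= rmorphXn /= !ncevalX opprK.
Qed.

Lemma nceval_cd_index (S : nzRingType) (x y : S) n Phi :
  is_cd_index n Phi -> nceval x y (Psi n) = nceval (x + y) (x * y + y * x) Phi.
Proof.
move->; rewrite nceval_comp.
have rmorph_d (f : {rmorphism ncpoly -> S}) a b :
    f (a * b + b * a) = f a * f b + f b * f a.
  by rewrite rmorphD /= !rmorphM.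
by rewrite rmorph_d rmorphD /= !ncevalX.
Qed.

Theorem theorem7p6 (n : nat) (hn : (1 <= n)%N) (Phi : ncpoly)
  (hPhi : is_cd_index n Phi) :
  let c := ncX false in
  let d := ncX true in
  nceval c (- d) (hat Phi) = nceval c (c ^+ 2 + d) Phi
  /\ sum_coef (nceval c (- d) (hat Phi)) = #|Rset n|%:Z.
Proof.
move=> c d; rewrite nceval_hat; split; first exact: erefl.
(* The sum of the coefficients is the value at [c = d = 1], which is that of [Phi] at 1 and
   [1 + 1]. *)
rewrite sum_coefE nceval_comp /= rmorphD /= rmorphXn /= !ncevalX.
rewrite expr1n; case: n hn hPhi => // n _ hPhi.
(* y^2 - y + 1 = 0: the companion matrix of a primitive sixth root of unity *)
pose y : 'M[int]_2 := \matrix_(i, j) if i == 0 then 1 else - (j == 0)%:R.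
pose x := 1 - y.
have xy1 : x + y = 1 by rewrite subrK.
have yx1 : y * x = 1.
  apply/matrixP => i j; rewrite !mxE !big_ord_recl big_ord0 !mxE.
  by move: i j => [[|[|//]] ?] [[|[|//]] ?].
have xyC : x * y = y * x by rewrite mulrBl mulrBr mul1r mulr1.
(* No integers satisfy [x + y = y * x = 1], hence the detour through matrices, in which the integers
   embed as scalars. *)
have scalar_inj : injective (@scalar_mx int 2).
  by move=> i j /(congr1 (fun M : 'M_2 => M 0 0)); rewrite !mxE.
apply: scalar_inj.
rewrite -[X in _ = X%:M]natz (rmorph_nat scalar_mx).
rewrite -(rmorph_Psi n (f := nceval x y)) /= ?ncevalX //.
rewrite (nceval_cd_index _ _ hPhi) xy1 xyC yx1 nceval_comp.
by rewrite rmorphD rmorph1.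
Qed.
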